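(* Let $n, m$ be integers with $n\geq 3$ and $m\geq 2$. Then the strong metric dimension of the jellyfish graph $JFG(n,m)$ is $nm-1$.
   Context: For integers $n\ge 3$, $m\ge 1$, the jellyfish graph $JFG(n,m)$ is the simple undirected graph of order $nm+n$ with vertex set $\{1,\dots,n\}\cup\{v_{ij} : 1\le i\le n,\ 1\le j\le m\}$ in which: the vertices $1,\dots,n$ induce the cycle $C_n$ (with edges $\{i,i+1\}$ for $1\le i\le n-1$ and $\{n,1\}$); each vertex $v_{ij}$ has degree $1$ and is adjacent exactly to $i$; there are no other edges. For a finite connected graph $\Gamma$, a vertex $w$ strongly resolves two vertices $u$ and $v$ if $u$ belongs to a shortest $v-w$ path or $v$ belongs to a shortest $u-w$ path. A set $N$ of vertices is a strong resolving set of $\Gamma$ if every two distinct vertices of $\Gamma$ are strongly resolved by some vertex of $N$. The strong metric dimension $sdim(\Gamma)$ is the minimum cardinality of a strong resolving set of $\Gamma$. *)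

(* Defs.v *)
From mathcomp Require Import all_boot.

Set Implicit Arguments.
Unset Strict Implicit.
Unset Printing Implicit Defensive.

(* A finite simple graph is a symmetric irreflexive relation e on a finType.
   In x :: p, the walk starts at x and has size p edges. *)

Section StrongResolving.
Variables (T : finType) (e : rel T).

Definition shortest_path (x y : T) (p : seq T) : Prop :=
  [/\ path e x p, last x p = y
    & forall q, path e x q -> last x q = y -> size p <= size q].

Definition on_shortest_path (u x y : T) : Prop :=
  exists2 p, shortest_path x y p & u \in x :: p.

Definition strongly_resolves (w u v : T) : Prop :=
  on_shortest_path u v w \/ on_shortest_path v u w.

Definition strong_resolving_set (N : {set T}) : Prop :=
  forall u v : T, u != v -> exists2 w, w \in N & strongly_resolves w u v.

(* The minimum exists when e is connected, since [set: T] is then strongly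
   resolving. *)
Definition is_sdim (k : nat) : Prop :=
  (exists2 N, strong_resolving_set N & #|N| = k) /\
  (forall N, strong_resolving_set N -> k <= #|N|).

End StrongResolving.

(* inl i is the cycle vertex i and inr (i, j) the pendant vertex v_ij, with
   indices starting at 0; ordS i is i + 1 modulo n. *)
Definition jellyfish (n m : nat) : rel ('I_n + 'I_n * 'I_m) :=
  fun x y => match x, y with
  | inl i, inl j => (j == ordS i) || (i == ordS j)
  | inl i, inr (k, _) => i == k
  | inr (k, _), inl i => i == k
  | inr _, inr _ => false
  end.
Arguments jellyfish : clear implicits.

Lemma jellyfish_sym n m : symmetric (jellyfish n m).
Proof. by move=> [i|[i a]] [j|[j b]] //=; rewrite orbC. Qed.

Lemma jellyfish_irr n m : 1 < n -> irreflexive (jellyfish n m).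
Proof.
move=> n_gt1 [i|[i a]] //=; rewrite orbb -val_eqE /=.
have:= ltn_ord i; rewrite leq_eqVlt => /orP[/eqP eq_in|lt_in].
  rewrite eq_in modnn; apply/eqP => i0.
  by rewrite -eq_in i0 in n_gt1.
by rewrite modn_small // ltn_eqF.
Qed.

Lemma card_jellyfish n m : #|{: 'I_n + 'I_n * 'I_m}| = n * m + n.
Proof. by rewrite card_sum card_prod !card_ord addnC. Qed.

Lemma jellyfish_connected n m x y : connect (jellyfish n m) x y.
Proof.
have csym := sym_connect_sym (@jellyfish_sym n m).
case: n x y csym => [|n] x y csym; first by case: x => [[]|[[]]].
suff c0 z : connect (jellyfish n.+1 m) (inl ord0) z.
  by apply: connect_trans (c0 y); rewrite csym.
have cyc i : connect (jellyfish n.+1 m) (inl ord0) (inl i).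
  case: i => k; elim: k => [|k IHk] lt_k.
    by rewrite (_ : Ordinal lt_k = ord0) //; apply: val_inj.
  apply: connect_trans (IHk (ltnW lt_k)) (connect1 _) => /=.
  by apply/orP; left; rewrite -val_eqE /= modn_small.
case: z => [i|[i a]] //; apply: connect_trans (cyc i) (connect1 _).
exact: eqxx.
Qed.

(* Main.v *)
(** A leaf is never an interior vertex of a shortest path, so two distinct
    leaves are strongly resolved only by themselves, and a strong resolving set
    misses at most one of the [n * m] leaves.  Conversely, all the leaves but
    one suffice: every path ending in a leaf attached to [i] goes through [i],
    so the cycle vertex [i] is strongly resolved from any other vertex by any
    leaf attached to it, and since [m >= 2] one such leaf is kept. *)
Require Import Defs.
From mathcomp Require Import all_boot.

Set Implicit Arguments.
Unset Strict Implicit.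
Unset Printing Implicit Defensive.

Section ShortestPaths.
Variables (T : finType) (e : rel T).

Lemma connect_shortest_path x y :
  connect e x y -> exists p, shortest_path e x y p.
Proof.
(* Walks of length [k] range over the finite type of [k]-tuples, so [P] is boolean and [ex_minnP]
   can pick the least length. *)
pose P k := [exists t : k.-tuple T, path e x t && (last x t == y)].
have PP q : path e x q -> last x q = y -> P (size q).
  by move=> e_q q_y; apply/existsP; exists (in_tuple q); rewrite /= e_q q_y /=.
case/connectP=> p0 e_p0 p0_y.
case: (ex_minnP (ex_intro P _ (PP _ e_p0 (esym p0_y)))) => k.
case/existsP=> t /andP[e_t /eqP t_y] min_k.
exists t; split=> // q e_q q_y.
by rewrite size_tuple min_k // PP.
Qed.

Lemma strongly_resolves_left u v : connect e v u -> strongly_resolves e u u v.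
Proof.
case/connect_shortest_path=> p sp_p; left; exists p => //.
by case: sp_p => _ <- _; apply: mem_last.
Qed.

Lemma strongly_resolves_sym w u v :
  strongly_resolves e w u v -> strongly_resolves e w v u.
Proof. by case; [right | left]. Qed.

(** A path from [v != w] to [w] has a last edge, and that edge can only start at [s]. *)
Lemma strongly_resolves_leaf_neighbor w s v :
  (forall x, e x w -> x = s) -> connect e v w -> v != w ->
  strongly_resolves e w s v.
Proof.
move=> leaf_w /connect_shortest_path[p sp_p] v'w; left; exists p => //.
case: sp_p => e_p p_w _; case/lastP: p e_p p_w => [|p z] /=.
  by move=> _ vw; rewrite vw eqxx in v'w.
rewrite rcons_path last_rcons => /andP[_ e_z] zw.
rewrite zw in e_z; rewrite -(leaf_w _ e_z) -rcons_cons mem_rcons inE.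
by rewrite mem_last orbT.
Qed.

Hypothesis e_sym : symmetric e.

(** If [u] were interior, its predecessor and successor on the path would both be [s]; cutting out
    the detour through [u] leaves a path two edges shorter. *)
Lemma leaf_on_shortest_path u s v w :
  (forall x, e x u -> x = s) -> on_shortest_path e u v w -> u != v -> u = w.
Proof.
move=> leaf_u [p [e_p p_w min_p]]; rewrite inE => /orP[-> //|u_p] _.
case/splitPr: u_p e_p p_w min_p => p1 [|z p2].
  by rewrite last_cat.
rewrite cat_path last_cat /= => /and4P[e_p1 e_u e_z e_p2] p2_w min_p.
have zE : z = last v p1 by rewrite (leaf_u _ e_u) (leaf_u z) // e_sym.
have := min_p (p1 ++ p2); rewrite cat_path last_cat -zE e_p1 e_p2 => /(_ isT p2_w).
by rewrite !size_cat leq_add2l ltnNge leqnSn.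
Qed.

Lemma leq_strong_resolving_set_leaves (L N : {set T}) :
  (forall u, u \in L -> exists s, forall x, e x u -> x = s) ->
  strong_resolving_set e N -> #|L| - 1 <= #|N|.
Proof.
(* Split [L] along [N]: the part outside [N] has at most one element, the part inside has at most
   [#|N|]. *)
move=> leaf_L res_N; rewrite leq_subLR -(cardsID N L) addnC leq_add //.
  apply/card_le1_eqP => u v; rewrite !inE => /andP[u'N uL] /andP[v'N vL].
  apply/esym/eqP/negPn/negP => u'v; have [w wN] := res_N u v u'v.
  have [s leaf_u] := leaf_L u uL; have [t leaf_v] := leaf_L v vL.
  case=> /leaf_on_shortest_path eq_w.
    by rewrite (eq_w _ leaf_u u'v) wN in u'N.
  by rewrite (eq_w _ leaf_v) ?wN // eq_sym in v'N.
exact: subset_leq_card (subsetIr _ _).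
Qed.

End ShortestPaths.

Section Jellyfish.
Variables n m : nat.

Definition jellyfish_leaves : {set 'I_n + 'I_n * 'I_m} :=
  [set inr ij | ij in [set: 'I_n * 'I_m]].

Lemma inr_jellyfish_leaves ij : inr ij \in jellyfish_leaves.
Proof. exact: imset_f. Qed.

Lemma card_jellyfish_leaves : #|jellyfish_leaves| = n * m.
Proof. by rewrite card_imset ?cardsT ?card_prod ?card_ord // => ? ? []. Qed.

Lemma jellyfish_leaf i a x : jellyfish n m x (inr (i, a)) -> x = inl i.
Proof. by case: x => [j /eqP->|[]]. Qed.

Lemma strong_resolving_jellyfish_leavesD1 (i0 : 'I_n) (a0 a1 : 'I_m) :
  a1 != a0 ->
  strong_resolving_set (jellyfish n m) (jellyfish_leaves :\ inr (i0, a0)).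
Proof.
set N := _ :\ _ => a1'0.
have NE ij : (inr ij \in N) = (ij != (i0, a0)).
  by rewrite in_setD1 inr_jellyfish_leaves andbT.
have res_cycle i v :
    exists2 w, w \in N & strongly_resolves (jellyfish n m) w (inl i) v.
  (* The index [a1] serves every [i], even [i0], since the removed leaf has index [a0]. *)
  exists (inr (i, a1)); first by rewrite NE xpair_eqE negb_and a1'0 orbT.
  have [->|v'w] := eqVneq v (inr (i, a1)).
    apply/strongly_resolves_sym/strongly_resolves_left.
    exact: jellyfish_connected.
  apply: strongly_resolves_leaf_neighbor v'w => [x|].
    exact: jellyfish_leaf.
  exact: jellyfish_connected.
move=> [i v _|u [j _|v u'v]]; first exact: res_cycle.
  have [w wN res_w] := res_cycle j (inr u).
  by exists w => //; apply: strongly_resolves_sym.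
(* Of two distinct leaves at least one is kept, and it resolves the pair as one of its endpoints. *)
have [u0|u'0] := eqVneq u (i0, a0).
  exists (inr v); first by rewrite NE -u0 eq_sym.
  apply/strongly_resolves_sym/strongly_resolves_left.
  exact: jellyfish_connected.
exists (inr u); first by rewrite NE.
apply: strongly_resolves_left; exact: jellyfish_connected.
Qed.

End Jellyfish.

Theorem theorem3p3 (n m : nat) (n_ge3 : 3 <= n) (m_ge2 : 2 <= m) :
  is_sdim (jellyfish n m) (n * m - 1).
Proof.
split=> [|N]; last first.
  rewrite -card_jellyfish_leaves.
  apply: leq_strong_resolving_set_leaves; first exact: jellyfish_sym.
  by move=> _ /imsetP[[i a] _ ->]; exists (inl i); apply: jellyfish_leaf.
pose i0 := Ordinal (ltnW (ltnW n_ge3)).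
(* The indices 0 and 1: [m_ge2] read as [1 < m] bounds [a1]. *)
pose a0 := Ordinal (ltnW m_ge2); pose a1 := Ordinal m_ge2.
exists (jellyfish_leaves n m :\ inr (i0, a0)).
  exact: (@strong_resolving_jellyfish_leavesD1 _ _ i0 a0 a1).
rewrite -card_jellyfish_leaves [in RHS](cardsD1 (inr (i0, a0))).
by rewrite inr_jellyfish_leaves addKn.
Qed.
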